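(* Let $1\le m\le N$ be integers, let $u:\Lambda^m\to\mathbb R$ be a function, and let $U:=G_{N,m}u$. Then: (i) $U$ is $d^Nx$-measurable if and only if $u$ is $d^mx$-measurable. (ii) $U\in L^\infty(\Lambda^N;d^Nx)$ if and only if $u\in L^\infty(\Lambda^m;d^mx)$. Moreover, there is a constant $C(N,m)$, depending only on $N$ and $m$, such that $$\|U\|_{\infty,d^Nx}\le\|u\|_{\infty,d^mx}\le C(N,m)\,\|U\|_{\infty,d^Nx},$$ with $C(N,1)=1$. In particular, $G_{N,m}$ is an isomorphism from $L^\infty(\Lambda^m;d^mx)$ onto a closed subspace of $L^\infty(\Lambda^N;d^Nx)$.
   Context: $(\Lambda;dx)$ is a complete $\sigma$-finite measure space with non-zero measure $dx$; for $k\in\mathbb N$, $d^kx$ denotes the completion of the product measure $dx^{\otimes k}$ on $\Lambda^k$; measurability and $L^\infty$ on $\Lambda^k$ are with respect to $d^kx$. For integers $1\le m\le N$ and a function $u:\Lambda^m\to\mathbb R$ (not assumed symmetric), $$(G_{N,m}u)(x_1,\dots,x_N)=\binom{N}{m}^{-1}\sum_{1\le i_1<\cdots<i_m\le N}u(x_{i_1},\dots,x_{i_m}).$$ *)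

(* Defs.v *)
From HB Require Import structures.
From mathcomp Require Import all_boot all_order all_algebra.
From mathcomp Require Import all_classical all_reals all_analysis.

Set Implicit Arguments.
Unset Strict Implicit.
Unset Printing Implicit Defensive.

Import Order.TTheory GRing.Theory Num.Theory.
Import numFieldNormedType.Exports.

Local Open Scope classical_set_scope.
Local Open Scope ring_scope.

(* Lambda^k is modelled as k.-tuple T, which carries (in MathComp-Analysis)
   the product sigma-algebra generated by the coordinate maps. *)

Section Defs.
Context {d : measure_display} {T : measurableType d} {R : realType}.
Variable mu : {measure set T -> \bar R}.

(* Iterated integral  \int ... \int f(x_1,...,x_k) dx_1 ... dx_k
   (x_1 outermost).  For a product-measurable set B and a sigma-finite mu,
   iint k (indicator of B) is (by Tonelli) the value of the product measure
   dx^{\otimes k} on B. *)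
Fixpoint iint (k : nat) : (k.-tuple T -> \bar R) -> \bar R :=
  match k return (k.-tuple T -> \bar R) -> \bar R with
  | 0 => fun f => f [tuple]
  | k'.+1 => fun f =>
      (\int[mu]_x iint (fun t : k'.-tuple T => f (cons_tuple x t)))%E
  end.

Definition prodmeas (k : nat) (B : set (k.-tuple T)) : \bar R :=
  iint (fun t => (\1_B t)%:E).

Definition dknull (k : nat) (A : set (k.-tuple T)) : Prop :=
  exists B : set (k.-tuple T),
    [/\ measurable B, A `<=` B & prodmeas B = 0%E].

(* d^k x-measurable sets: the completion of the product sigma-algebra,
   i.e. sets differing from a product-measurable set by a d^k x-null set *)
Definition dkmeasurable (k : nat) (A : set (k.-tuple T)) : Prop :=
  exists B : set (k.-tuple T), measurable B /\ dknull ((A `\` B) `|` (B `\` A)).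

Definition dkmeasurable_fun (k : nat) (f : k.-tuple T -> R) : Prop :=
  forall Y : set R, measurable Y -> dkmeasurable (f @^-1` Y).

Definition dknorm_inf (k : nat) (f : k.-tuple T -> R) : \bar R :=
  ereal_inf [set M : \bar R | dknull [set x | (M < (`|f x|)%:E)%E]].

Definition dkLinf (k : nat) (f : k.-tuple T -> R) : Prop :=
  dkmeasurable_fun f /\ (dknorm_inf f < +oo)%E.

End Defs.

Definition Gop {T : Type} {R : realType} (N m : nat) (u : m.-tuple T -> R)
    (x : N.-tuple T) : R :=
  ('C(N, m)%:R)^-1 *
  \sum_(s : {ffun 'I_m -> 'I_N} |
          [forall i : 'I_m, forall j : 'I_m, (i < j)%N ==> (s i < s j)%N])
     u [tuple tnth x (s i) | i < m].
Arguments Gop {T R} N m u x.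

(* Main.v *)
(** Proof idea. Let the coordinates be letters of words over nat.  The algebraic
    core is that, for words with distinct letters, [phi w] is a finite linear
    combination of the sums of [phi] over the m-subwords of words [W] of length
    N, with [W] and the coefficients depending only on N and m.  It goes by
    induction on m, for sums with positive weights: the differences
    [phi (x :: v) - phi (y :: v)] only see the subwords using the first letter,
    so they fall under the induction hypothesis; modulo these differences the
    first letter may be replaced by a fixed one, which turns the sum over
    (m+1)-subwords into a sum over m-subwords, again with positive weights.

    Hence u, composed with the projection onto the last m of K + m coordinates,
    is a linear combination of the functions U(z_{i_1}, ..., z_{i_N}) with
    distinct indices.  By Tonelli, null sets pull back to null sets along
    such coordinate selections, and a set whose cylinder is null (or measurable)
    is itself null (or measurable), because almost every section of the
    cylinder is the set itself.  The constant is the sum of the absolute values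
    of the coefficients; for m = 1 the constant 1 comes from U > M on A^N, with
    A = {u > M}, since A^N is null only if A is. *)

Require Import Defs.
From HB Require Import structures.
From mathcomp Require Import all_boot all_order all_algebra.
From mathcomp Require Import all_classical all_reals all_analysis.
From mathcomp Require Import measurable_realfun.
From mathcomp Require Import ring zify.
Import Order.TTheory GRing.Theory Num.Theory.
Import numFieldNormedType.Exports.
Set Implicit Arguments.
Unset Strict Implicit.
Unset Printing Implicit Defensive.
Local Open Scope classical_set_scope.
Local Open Scope ring_scope.

(** * Sums over subwords *)

Section WeightedSubwords.
Variable R : realFieldType.

(* Sum of [phi] over the subwords of [W] of length [m]; the weight [c b] of a
   subword depends on the mask [b] selecting its positions. *)
Fixpoint wsub (A : Type) (c : bitseq -> R) (phi : seq A -> R) (m : nat)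
    (W : seq A) : R :=
  match W with
  | [::] => if m is 0 then c [::] * phi [::] else 0
  | x :: W' =>
      (if m is m'.+1 then wsub (fun b => c (true :: b)) (fun v => phi (x :: v)) m' W'
       else 0) + wsub (fun b => c (false :: b)) phi m W'
  end.

Lemma wsubDw A (c c' : bitseq -> R) (phi : seq A -> R) m W :
  wsub (fun b => c b + c' b) phi m W = wsub c phi m W + wsub c' phi m W.
Proof.
elim: W m c c' phi => [|x W IH] [|m] c c' phi /=; rewrite ?addr0 ?mulrDl //.
  by rewrite IH !add0r.
by rewrite !IH addrACA.
Qed.

Lemma wsub0w A (phi : seq A -> R) m W : wsub (fun=> 0) phi m W = 0.
Proof.
by elim: W m phi => [|x W IH] [|m] phi /=; rewrite ?mul0r ?IH ?addr0.
Qed.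

Lemma wsubB A (c : bitseq -> R) (phi psi : seq A -> R) m W :
  wsub c (fun v => phi v - psi v) m W = wsub c phi m W - wsub c psi m W.
Proof.
elim: W m c phi psi => [|x W IH] [|m] c phi psi /=; rewrite ?subr0 ?mulrBr //.
  by rewrite IH !add0r.
by rewrite !IH; ring.
Qed.

Lemma wsub_size0 A (c : bitseq -> R) (phi : seq A -> R) W :
  wsub c phi 0 W = c (nseq (size W) false) * phi [::].
Proof. by elim: W c => [|x W IH] c //=; rewrite add0r IH. Qed.

(* The weights after the first letter of each subword is forgotten: the weight
   of a mask [b] gathers those of the masks adding one position before the
   first one selected by [b]. *)
Fixpoint shiftw (c : bitseq -> R) (b : bitseq) : R :=
  if b is b0 :: b' then
    if b0 then 0 else c (true :: b') + shiftw (fun b => c (false :: b)) b'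
  else 0.

Lemma shiftw_ge0 c : (forall b, 0 <= c b) -> forall b, 0 <= shiftw c b.
Proof.
move=> c0 b; elim: b c c0 => [|[] b IH] c c0 //=.
by rewrite addr_ge0// IH.
Qed.

Lemma wsub_behead A (c : bitseq -> R) (f : seq A -> R) m W :
  wsub c (fun v => f (behead v)) m.+1 W = wsub (shiftw c) f m W.
Proof.
elim: W m c f => [|x W IH] m c f /=; first by case: m; rewrite ?mul0r.
rewrite IH wsubDw; case: m => [|m]; first by rewrite add0r.
by rewrite wsub0w add0r.
Qed.

Definition avoids (s W : seq nat) := all (fun x => x \notin s) W.

(** The combination [L] is fixed before [phi]; this uniformity is what later makes the constant
    depend on [N] and [m] only. *)
Definition wspan (c : bitseq -> R) (m N : nat) (s : seq nat)
    (Psi : (seq nat -> R) -> R) :=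
  exists L : seq (R * seq nat),
    (forall p, p \in L -> [/\ uniq p.2, size p.2 = N & avoids s p.2]) /\
    forall phi, Psi phi = \sum_(p <- L) p.1 * wsub c phi m p.2.

Lemma wspan_lin c m N s a P Q : wspan c m N s P -> wspan c m N s Q ->
  wspan c m N s (fun phi => a * P phi + Q phi).
Proof.
move=> [L1 [H1 E1]] [L2 [H2 E2]].
exists ([seq (a * p.1, p.2) | p <- L1] ++ L2); split.
  move=> p; rewrite mem_cat => /orP[/mapP[q qL ->]|]; last exact: H2.
  exact: (H1 q qL).
move=> phi; rewrite big_cat big_map /= E1 E2; congr (_ + _).
by rewrite mulr_sumr; apply: eq_bigr => p _; rewrite mulrA.
Qed.

Lemma wspan0 c m N s : wspan c m N s (fun=> 0).
Proof. by exists [::]; split => // phi; rewrite big_nil. Qed.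

Lemma wspan_ext c m N s P Q : (forall phi, P phi = Q phi) ->
  wspan c m N s P -> wspan c m N s Q.
Proof. by move=> PQ [L [H E]]; exists L; split=> // phi; rewrite -PQ E. Qed.

Lemma wspan_sum (I : eqType) c m N s (r : seq I) (al : I -> R) P :
  (forall i, i \in r -> wspan c m N s (P i)) ->
  wspan c m N s (fun phi => \sum_(i <- r) al i * P i phi).
Proof.
elim: r => [|i r IH] H.
  by apply: wspan_ext (wspan0 _ _ _ _) => phi; rewrite big_nil.
apply: wspan_ext (wspan_lin (al i) (H i (mem_head _ _)) (IH _)) => [phi|j jr].
  by rewrite big_cons.
by apply: H; rewrite inE jr orbT.
Qed.

Lemma wspan_word c m N s W : uniq W -> size W = N -> avoids s W ->
  wspan c m N s (fun phi => wsub c phi m W).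
Proof.
move=> uW sW aW; exists [:: (1, W)]; split.
  by move=> p; rewrite inE => /eqP ->.
by move=> phi; rewrite big_seq1 mul1r.
Qed.

Lemma wspan_wsub c m N s c2 k W (psi : (seq nat -> R) -> seq nat -> R) :
  (forall v, subseq v W -> size v = k -> wspan c m N s (fun phi => psi phi v)) ->
  wspan c m N s (fun phi => wsub c2 (psi phi) k W).
Proof.
elim: W k c2 psi => [|x W IH] k c2 psi H /=.
  case: k H => [H|k _]; last exact: wspan0.
  apply: wspan_ext (wspan_lin (c2 [::]) (H [::] _ _) (wspan0 _ _ _ _)) => //.
  by move=> phi; rewrite addr0.
have S2 : wspan c m N s (fun phi => wsub (fun b => c2 (false :: b)) (psi phi) k W).
  by apply: IH => v vW; apply: H; apply: subseq_trans (subseq_cons _ _).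
case: k H S2 => [|k] H S2; first by apply: wspan_ext S2 => phi; rewrite add0r.
apply: wspan_ext (wspan_lin 1 (IH k (fun b => c2 (true :: b)) (fun phi v => psi phi (x :: v)) _) S2).
  by move=> phi; rewrite mul1r.
by move=> v vW sv; apply: H; rewrite /= ?eqxx ?sv.
Qed.

Lemma fresh_letter (s : seq nat) : exists y, y \notin s.
Proof.
exists (sumn s).+1; apply/negP.
suff H x : x \in s -> (x <= sumn s)%N by move/H; rewrite ltnn.
elim: s => [|z s IH] //=; rewrite inE => /orP[/eqP ->|/IH]; lia.
Qed.

Lemma fresh_word (s : seq nat) N : exists W, [/\ uniq W, size W = N & avoids s W].
Proof.
elim: N => [|N [W [uW sW aW]]]; first by exists [::].
have [y] := fresh_letter (s ++ W); rewrite mem_cat negb_or => /andP[ys yW].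
by exists (y :: W); rewrite /= yW uW sW ys.
Qed.

Lemma avoids_cons y s W : avoids (y :: s) W = (y \notin W) && avoids s W.
Proof.
rewrite /avoids; elim: W => [|x W IH] //=; rewrite IH !inE !negb_or (eq_sym x y).
by rewrite -!andbA; do !bool_congr.
Qed.

(* The list [s] of letters to avoid keeps the auxiliary letters of the
   successive induction steps distinct. *)
Lemma word_wspan c m N s w : (forall b, 0 < c b) -> (m <= N)%N ->
  uniq w -> size w = m -> avoids s w -> wspan c m N s (fun phi => phi w).
Proof.
elim: m N c s w => [|m IH] N c s w c0 mN uw sw aw.
  case: w sw {uw aw} => // _.
  (* For [m = 0] only the empty subword occurs, with the all-false mask; its weight is positive and
     can be divided out. *)
  have [W [uW sW aW]] := fresh_word s N.
  apply: wspan_ext (wspan_lin (c (nseq N false))^-1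
    (wspan_word c 0 uW sW aW) (wspan0 _ _ _ _)) => phi.
  by rewrite wsub_size0 sW addr0 mulKf// gt_eqF.
case: N mN => // N mN.
(* Subwords omitting the first letter cancel between [x :: p.2] and [y :: p.2]. What remains is an
   [m]-subword sum of the function sending [v] to [phi (x :: v) - phi (y :: v)], with weights
   [c (true :: b)]: the induction hypothesis applies to it. *)
have hdiff x y v : x != y -> x \notin s -> y \notin s -> x \notin v -> y \notin v ->
    uniq v -> size v = m -> avoids s v ->
    wspan c m.+1 N.+1 s (fun phi => phi (x :: v) - phi (y :: v)).
  move=> xy xs ys xv yv uv sv av.
  have [||L [HL EL]] := IH N (fun b => c (true :: b)) (x :: y :: s) v _ mN uv sv.
  - by move=> b; exact: c0.
  - by rewrite !avoids_cons xv yv.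
  have HL' z : z \in [:: x; y] -> z \notin s -> forall p, p \in L ->
      wspan c m.+1 N.+1 s (fun phi => wsub c phi m.+1 (z :: p.2)).
    move=> zxy zs p /HL[up sp]; rewrite !avoids_cons => /and3P[xp yp ap].
    apply: wspan_word; rewrite /= ?up ?sp ?ap ?zs ?andbT//.
    by move: zxy; rewrite !inE => /orP[]/eqP ->.
  have S1 := wspan_sum (fun p => p.1) (HL' x (mem_head _ _) xs).
  have S2 := wspan_sum (fun p => p.1) (HL' y (mem_last x [:: y]) ys).
  apply: wspan_ext (wspan_lin (-1) S2 S1) => phi.
  rewrite (EL (fun v => phi (x :: v) - phi (y :: v))) mulN1r addrC -sumrB.
  by apply: eq_bigr => p _; rewrite wsubB /=; ring.
case: w uw sw aw => [//|x w] /= /andP[xw uw] [sw] /andP[xs aw].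
(* [y] is the fixed first letter; [z] lengthens words of length [N] to length [N.+1]. *)
have [y] := fresh_letter (x :: w ++ s); rewrite inE mem_cat !negb_or.
move=> /and3P[yx yw ys].
have [z] := fresh_letter (y :: w ++ s); rewrite inE mem_cat !negb_or.
move=> /and3P[zy zw zs].
(* When the first letter of each subword of [z :: p.2] is replaced by [y], a tail collects the
   weight for the first letter [z] and, through [shiftw], those for the earlier letters of [p.2].
   The new weights are no longer 1 but stay positive, hence the induction over arbitrary positive
   weights. *)
pose c' b := c (true :: b) + shiftw (fun b => c (false :: b)) b.
have c'0 b : 0 < c' b by rewrite ltr_wpDr ?shiftw_ge0// => ?; exact: ltW.
have [|L [HL EL]] := IH N c' (y :: z :: s) w c'0 mN uw sw.
  by rewrite !avoids_cons yw zw.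
(* Each [c']-weighted sum is the full sum [T1] minus the correction [T2], whose terms
   [phi (a :: v) - phi (y :: v)] are covered by [hdiff]. *)
have S1 : wspan c m.+1 N.+1 s (fun phi => phi (y :: w)).
  apply: wspan_ext (wspan_sum (fun p => p.1) (_ : forall p, p \in L ->
    wspan c m.+1 N.+1 s (fun phi => wsub c' (fun v => phi (y :: v)) m p.2))).
    by move=> phi; rewrite (EL (fun v => phi (y :: v))).
  move=> p /HL[up sp]; rewrite !avoids_cons => /and3P[yp zp ap].
  have uzp : uniq (z :: p.2) by rewrite /= zp.
  have azp : avoids s (z :: p.2) by rewrite /= zs.
  have T1 : wspan c m.+1 N.+1 s (fun phi => wsub c phi m.+1 (z :: p.2)).
    by apply: wspan_word; rewrite //= sp.
  have T2 : wspan c m.+1 N.+1 s (fun phi =>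
      wsub c (fun v => phi v - phi (y :: behead v)) m.+1 (z :: p.2)).
    apply: (@wspan_wsub _ _ _ _ _ _ _ (fun phi v => phi v - phi (y :: behead v))).
    move=> [|a v] // vW [sv] /=.
    have := subseq_uniq vW uzp => /= /andP[av uv].
    have asub t : t \in a :: v -> (t \notin s) /\ (t != y).
      move=> /(mem_subseq vW) tW; split; first by move/allP: azp => /(_ _ tW).
      by move: tW; rewrite inE => /orP[/eqP ->//|]; apply: contraTneq => ->.
    have [as_ ay] := asub a (mem_head _ _).
    apply: hdiff => //.
      by apply/negP => yv; have [] := asub y; rewrite ?inE ?yv ?orbT ?eqxx.
    by apply/allP => t tv; have [] := asub t; rewrite // inE tv orbT.
  apply: wspan_ext (wspan_lin (-1) T2 T1) => phi.
  rewrite wsubB /= (wsub_behead (fun b => c (false :: b)) (fun v => phi (y :: v))).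
  rewrite wsubDw /=; ring.
apply: wspan_ext (wspan_lin 1 (hdiff x y w _ xs ys xw yw uw sw aw) S1).
  by move=> phi; ring.
by rewrite eq_sym.
Qed.

(** * Subwords and strictly increasing maps *)

Fixpoint subwords (A : Type) (m : nat) (W : seq A) : seq (seq A) :=
  match W with
  | [::] => if m is 0 then [:: [::]] else [::]
  | x :: W' =>
      (if m is m'.+1 then [seq x :: v | v <- subwords m' W'] else [::])
      ++ subwords m W'
  end.

Lemma wsub1E A (phi : seq A -> R) m W :
  wsub (fun=> 1) phi m W = \sum_(v <- subwords m W) phi v.
Proof.
elim: W m phi => [|x W IH] [|m] phi /=.
- by rewrite mul1r big_seq1.
- by rewrite big_nil.
- by rewrite add0r IH.
- by rewrite !IH big_cat big_map.
Qed.

Lemma size_subwords A m (W : seq A) : size (subwords m W) = 'C(size W, m).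
Proof.
elim: W m => [|x W IH] [|m] //=; first by rewrite IH !bin0.
by rewrite size_cat size_map !IH binS addnC.
Qed.

Lemma map_subwords A B (f : A -> B) m W :
  subwords m (map f W) = map (map f) (subwords m W).
Proof.
elim: W m => [|x W IH] [|m] //=.
by rewrite map_cat !IH -!map_comp.
Qed.

Lemma mem_subwords (A : eqType) m (W v : seq A) :
  (v \in subwords m W) = (subseq v W) && (size v == m).
Proof.
elim: W m v => [|x W IH] m v /=.
  by case: m => [|m]; case: v.
rewrite mem_cat IH; case: v => [|y v] /=.
  case: m => [|m] /=; first by rewrite sub0seq.
  by rewrite andbF orbF; apply/negP => /mapP[].
case: ifPn => [/eqP ->|yx].
  case: m => [|m] /=; first by rewrite !andbF.
  rewrite (_ : _ \in map _ _ = (v \in subwords m W)); last first.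
    by apply/mapP/idP => [[u uW [->]]//|vW]; exists v.
  rewrite IH eqSS; case: (size v == m) => /=; rewrite ?andbF// !andbT.
  by apply/orP/idP => [[//|]|]; [exact: subseq_trans (subseq_cons _ _)|left].
case: m => [|m] //=; case: mapP => // -[u _ [/eqP]].
by rewrite (negPf yx).
Qed.

Lemma uniq_subwords (A : eqType) m (W : seq A) : uniq W -> uniq (subwords m W).
Proof.
elim: W m => [|x W IH] [|m] //= /andP[xW uW]; first exact: IH.
rewrite cat_uniq IH// map_inj_uniq ?IH// ?andbT; last by move=> ? ? [].
apply/hasPn => v; rewrite mem_subwords => /andP[vW _].
apply/negP => /mapP[u _ E]; move: vW; rewrite E => /mem_subseq/(_ x (mem_head _ _)).
by rewrite (negPf xW).
Qed.

Lemma subseq_enum_ord N (v : seq 'I_N) :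
  subseq v (enum 'I_N) = sorted (fun i j : 'I_N => (i < j)%N) v.
Proof.
have tr : transitive (fun i j : 'I_N => (i < j)%N) by move=> ? ? ?; exact: ltn_trans.
have sE : sorted (fun i j : 'I_N => (i < j)%N) (enum 'I_N).
  by rewrite -(sorted_map (f := val) (e' := ltn)) val_enum_ord iota_ltn_sorted.
apply/idP/idP => [vE|sv]; first exact: subseq_sorted vE sE.
(* A strictly increasing list is determined by its set of elements. *)
rewrite (_ : v = [seq i <- enum 'I_N | i \in v]) ?filter_subseq//.
apply: irr_sorted_eq sv _ _ => //.
- by move=> i; rewrite /= ltnn.
- exact: sorted_filter.
- by move=> i; rewrite mem_filter mem_enum andbT.
Qed.

(** Listing the values of a strictly increasing map is a bijection onto the subwords; this turns the
    sum in [Gop] into a subword sum. *)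
Lemma sum_increasing (N m : nat) (h : seq 'I_N -> R) :
  \sum_(s : {ffun 'I_m -> 'I_N} |
     [forall i : 'I_m, forall j : 'I_m, (i < j)%N ==> (s i < s j)%N])
    h [seq s i | i <- enum 'I_m] = \sum_(v <- subwords m (enum 'I_N)) h v.
Proof.
rewrite -big_filter.
rewrite -(big_map (fun s : {ffun 'I_m -> 'I_N} => [seq s i | i <- enum 'I_m]) xpredT h).
apply: perm_big; apply: uniq_perm.
- rewrite map_inj_uniq ?filter_uniq ?index_enum_uniq// => s t st.
  by apply/ffunP => i; move/eq_in_map: st; apply; rewrite mem_enum.
- by rewrite uniq_subwords ?enum_uniq.
move=> v; rewrite mem_subwords subseq_enum_ord.
have sE : sorted (fun i j : 'I_m => (i < j)%N) (enum 'I_m) by rewrite -subseq_enum_ord.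
apply/mapP/andP => [[s]|[sv /eqP zv]].
  rewrite mem_filter => /andP[/forallP sinc _] ->.
  rewrite size_map size_enum_ord sorted_map; split=> //.
  by apply: sub_sorted sE => i j; move: (sinc i) => /forallP/(_ j)/implyP.
rewrite -{}zv in sE *; exists [ffun i => tnth (in_tuple v) i]; last first.
  by rewrite (eq_map (ffunE _)) map_tnth_enum.
rewrite mem_filter mem_index_enum andbT; apply/forallP => i; apply/forallP => j.
apply/implyP => ij; rewrite !ffunE.
have x0 : 'I_N := tnth (in_tuple v) i.
rewrite !(tnth_nth x0) /=.
apply: (sorted_ltn_nth (leT := fun i j : 'I_N => (i < j)%N)) => //; rewrite ?inE//.
by move=> ? ? ?; exact: ltn_trans.
Qed.

End WeightedSubwords.

(** * Null sets and coordinate selections *)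

Definition tsel (T : Type) M N (s : 'I_N -> 'I_M) (z : M.-tuple T) : N.-tuple T :=
  [tuple tnth z (s i) | i < N].

Lemma product_pushforward d1 d2 d3 (X : measurableType d1) (Y : measurableType d2)
    (Z : measurableType d3) (R : realType)
    (m1 : {sigma_finite_measure set X -> \bar R})
    (m2 : {sigma_finite_measure set Y -> \bar R}) (f : X * Y -> Z) (g : Z -> X * Y) :
  measurable_fun setT f -> measurable_fun setT g -> cancel f g ->
  exists p : {sigma_finite_measure set Z -> \bar R},
    forall A, p A = (\int[m1]_x m2 [set y | A (f (x, y))])%E.
Proof.
move=> mf mg gK.
pose nu := [the {measure set _ -> \bar R} of (m1 \x m2)%E].
pose p : {measure set Z -> \bar R} :=
  measure_function_pushforward__canonical__measure_function_Measure nu mf.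
have sf : sigma_finite setT p.
  have [F FT mF] : sigma_finite setT nu.
    have /sigma_finiteP[F [TF ndF Foo]] := sigma_finiteT m1.
    have /sigma_finiteP[G [TG ndG Goo]] := sigma_finiteT m2.
    (* Both exhaustions are nondecreasing, so [maxn n k] serves as a common index. *)
    exists (fun n => F n `*` G n).
      rewrite -setXTT TF TG predeqE => -[x y]; split.
        move=> [/= [n _ Fnx] [k _ Gky]]; exists (maxn n k) => //; split.
        - by move: x Fnx; exact/subsetPset/ndF/leq_maxl.
        - by move: y Gky; exact/subsetPset/ndG/leq_maxr.
      by move=> [n _ []/= ? ?]; split; exists n.
    move=> k; have [? ?] := Foo k; have [? ?] := Goo k.
    split; first exact: measurableX.
    by rewrite /= product_measure1E// lte_mul_pinfty// ge0_fin_numE.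
  exists (fun n => g @^-1` F n); first by rewrite -preimage_bigcup -FT.
  move=> n; have [mFn nFn] := mF n; split.
    by rewrite -[X in measurable X]setTI; exact: mg.
  rewrite /p /= /pushforward -comp_preimage (_ : g \o _ = id) ?preimage_id//.
  by apply/funext => q; exact: gK.
pose pS := Measure_isSigmaFinite.Build _ _ _ p sf.
pose p' : {sigma_finite_measure set Z -> \bar R} := HB.pack (p : set _ -> \bar R) p pS.
exists p' => A; rewrite /p' /= /pushforward /product_measure1.
by apply: eq_integral => x _ /=; rewrite xsectionE.
Qed.

(** * The product measure and its null sets *)

Section ProductMeasure.
Context {d : measure_display} {T : measurableType d} {R : realType}.
Variable mu : {sigma_finite_measure set T -> \bar R}.
Definition consp k (p : T * k.-tuple T) : k.+1.-tuple T := cons_tuple p.1 p.2.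
Lemma measurable_consp k : measurable_fun setT (@consp k).
Proof.
apply: (@measurable_cons _ _ (T * k.-tuple T)%type T fst k snd); [exact: measurable_fst|exact: measurable_snd].
Qed.

Lemma prodmeas_cons k (B : set (k.+1.-tuple T)) :
  prodmeas mu B = (\int[mu]_x prodmeas mu (cons_tuple x @^-1` B))%E.
Proof. by []. Qed.

(** Makes the iterated integral a genuine measure, so that the calculus of negligible sets applies.
    Sigma-finiteness is carried along for the next product; on the one-point space of 0-tuples the
    measure is a Dirac mass. *)
Lemma prodmeas_measure k :
  exists nu : {sigma_finite_measure set (k.-tuple T) -> \bar R},
    forall B, measurable B -> nu B = prodmeas mu B.
Proof.
elim: k => [|k [nu nuE]].
  pose t0 : 0.-tuple T := [tuple].
  pose nu : {sigma_finite_measure set (0.-tuple T) -> \bar R} := \d_t0.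
  by exists nu.
pose g (t : k.+1.-tuple T) := (thead t, behead_tuple t).
have mg : measurable_fun setT g.
  apply: measurable_fun_pair; first exact: measurable_tnth.
  exact: measurable_behead.
have gK : cancel (@consp k) g.
  by case=> a b; rewrite /g /consp /=; congr pair; exact: val_inj.
have [p pE] := product_pushforward mu nu (@measurable_consp k) mg gK.
exists p => B mB; rewrite pE prodmeas_cons.
apply: eq_integral => x _ /=; rewrite -nuE//.
rewrite -[X in measurable X]setTI.
exact: (measurable_cons (f := cst x) (g := id)).
Qed.

Definition prodm k := projT1 (cid (prodmeas_measure k)).

Lemma prodmE k B : measurable B -> prodm k B = prodmeas mu B.
Proof. by rewrite /prodm; case: cid => /= nu + mB; apply. Qed.

Lemma dknullE k (A : set (k.-tuple T)) : dknull mu A <-> (prodm k).-negligible A.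
Proof.
split=> -[B]; first by case=> mB AB B0; exists B; rewrite prodmE.
by case=> mB B0 AB; exists B; rewrite -prodmE.
Qed.

Lemma dknullS k (A B : set (k.-tuple T)) : A `<=` B -> dknull mu B -> dknull mu A.
Proof. by move=> AB /dknullE B0; apply/dknullE; exact: negligibleS B0. Qed.

Lemma dknullU k (A B : set (k.-tuple T)) :
  dknull mu A -> dknull mu B -> dknull mu (A `|` B).
Proof. by move=> /dknullE A0 /dknullE B0; apply/dknullE; exact: negligibleU. Qed.

Lemma dknull_bigcup k (F : (set (k.-tuple T))^nat) :
  (forall n, dknull mu (F n)) -> dknull mu (\bigcup_n F n).
Proof. by move=> F0; apply/dknullE/negligible_bigcup => n; exact/dknullE. Qed.

Lemma dknull0 k : dknull mu (set0 : set (k.-tuple T)).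
Proof. by apply/dknullE; exact: negligible_set0. Qed.

Lemma dknullP k (B : set (k.-tuple T)) : measurable B ->
  dknull mu B <-> prodmeas mu B = 0%E.
Proof. by move=> mB; rewrite dknullE -prodmE//; exact: negligibleP. Qed.

Lemma prodmeas_ge0 k (B : set (k.-tuple T)) : measurable B -> (0 <= prodmeas mu B)%E.
Proof. by move=> mB; rewrite -prodmE. Qed.

Lemma measurable_prodmeas_section d' (X : measurableType d') k (Q : X -> set (k.-tuple T)) :
  measurable [set p : X * k.-tuple T | Q p.1 p.2] ->
  measurable_fun setT ((fun x => prodmeas mu (Q x)) : X -> \bar R).
Proof.
move=> mQ.
have := measurable_fun_xsection (prodm k) mQ.
rewrite (_ : _ \o _ = (fun x => prodmeas mu (Q x)))//.
apply/funext => x /=; rewrite -prodmE.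
  by congr (prodm k _); rewrite xsectionE.
have := measurable_xsection x mQ.
by rewrite xsectionE.
Qed.

Lemma ge0_integral_eq0P (g : T -> \bar R) : measurable_fun setT g ->
  (forall x, 0 <= g x)%E ->
  (\int[mu]_x g x = 0)%E <-> mu.-negligible [set x | g x != 0%E].
Proof.
move=> mg g0.
have -> : (\int[mu]_x g x = \int[mu]_x `|g x|)%E.
  by apply: eq_integral => x _; rewrite gee0_abs.
rewrite ae_eq_integral_abs// /ae_eq /=.
split=> [[A [mA A0 gA]]|[A [mA A0 gA]]]; exists A; split=> // x /=.
  by move=> gx; apply: gA => /= /(_ Logic.I) /eqP; rewrite (negPf gx).
by move=> gx; apply: gA; apply/eqP => gx0; apply: gx.
Qed.

(** [unlift i j] is [None] exactly at [j = i], where the default [x] is taken. *)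
Definition ins k (i : 'I_k.+1) (x : T) (t : k.-tuple T) : k.+1.-tuple T :=
  [tuple oapp (tnth t) x (unlift i j) | j < k.+1].

Lemma ins0 k x (t : k.-tuple T) : ins ord0 x t = cons_tuple x t.
Proof.
apply: eq_from_tnth => j; rewrite tnth_mktuple.
by case: unliftP => [l ->|->] /=; rewrite ?tnthS.
Qed.

Lemma insS k (i : 'I_k.+1) x y (t : k.-tuple T) :
  ins (lift ord0 i) x (cons_tuple y t) = cons_tuple y (ins i x t).
Proof.
apply: eq_from_tnth => j; rewrite tnth_mktuple.
case: (unliftP ord0 j) => [l ->|->]; last first.
  by rewrite (_ : ord0 = lift (lift ord0 i) ord0) ?liftK//; apply: val_inj.
rewrite tnthS tnth_mktuple; case: (unliftP i l) => [a ->|->] /=.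
  rewrite (_ : lift ord0 (lift i a) = lift (lift ord0 i) (lift ord0 a)).
    by rewrite liftK /= tnthS.
  by apply: val_inj; rewrite /= /bump /=; lia.
by rewrite unlift_none.
Qed.

Lemma measurable_ins d' (X : measurableType d') k (i : 'I_k.+1) (f : X -> T)
    (g : X -> k.-tuple T) : measurable_fun setT f -> measurable_fun setT g ->
  measurable_fun setT (fun x => ins i (f x) (g x)).
Proof.
move=> mf mg; apply/measurable_fun_tnthP => j /=.
rewrite (_ : _ \o _ = fun x => oapp (tnth (g x)) (f x) (unlift i j)).
  case: unlift => [l|] //=.
  apply: (@measurableT_comp _ _ _ _ _ _ (fun x => tnth x l)) => //=.
  exact: measurable_tnth.
by apply/funext => x /=; rewrite tnth_mktuple.
Qed.

(** By Tonelli any coordinate may be integrated outermost: the induction brings it to second place,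
    and one exchange of integrals moves it to the front. *)
Lemma prodmeas_ins k (i : 'I_k.+1) (B : set (k.+1.-tuple T)) : measurable B ->
  prodmeas mu B = (\int[mu]_x prodmeas mu (ins i x @^-1` B))%E.
Proof.
elim: k i B => [|k IH] i B mB.
  rewrite ord1 prodmeas_cons; apply: eq_integral => x _; congr prodmeas.
  by apply/seteqP; split=> t /=; rewrite ins0.
case: (unliftP ord0 i) => [l ->|->]; last first.
  rewrite prodmeas_cons; apply: eq_integral => x _; congr prodmeas.
  by apply/seteqP; split=> t /=; rewrite ins0.
pose F (p : T * T) := prodmeas mu [set t | B (cons_tuple p.1 (ins l p.2 t))].
have mF : measurable_fun setT F.
  apply: measurable_prodmeas_section.
  rewrite -[X in measurable X]setTI.
  apply: (_ : measurable_fun setT (fun p : (T * T) * k.-tuple T =>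
    cons_tuple p.1.1 (ins l p.1.2 p.2))) => //.
  apply: (measurable_cons (f := fun p : (T * T) * k.-tuple T => p.1.1)
    (g := fun p => ins l p.1.2 p.2)); first exact: measurableT_comp.
  by apply: measurable_ins => //; exact: measurableT_comp.
have F0 p : (0 <= F p)%E.
  apply: prodmeas_ge0; rewrite -[X in measurable X]setTI.
  apply: (_ : measurable_fun setT (fun t => cons_tuple p.1 (ins l p.2 t))) => //.
  apply: (measurable_cons (f := cst p.1) (g := fun t => ins l p.2 t)) => //.
  by apply: (measurable_ins _ (f := cst p.2)).
transitivity (\int[mu]_x \int[mu]_y F (x, y))%E.
  rewrite prodmeas_cons; apply: eq_integral => x _; rewrite (IH l)//.
  rewrite -[X in measurable X]setTI.
  exact: (measurable_cons (f := cst x) (g := id)).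
rewrite (fubini_tonelli F mF F0); apply: eq_integral => x _.
rewrite prodmeas_cons; apply: eq_integral => y _; congr prodmeas.
by apply/seteqP; split=> t /=; rewrite insS.
Qed.

(** * Pullback along coordinate selections *)

Lemma measurable_tsel M N (s : 'I_N -> 'I_M) : measurable_fun setT (tsel s : M.-tuple T -> N.-tuple T).
Proof.
apply/measurable_fun_tnthP => j /=.
rewrite (_ : _ \o _ = fun x => tnth x (s j)); first exact: measurable_tnth.
by apply/funext => x /=; rewrite tnth_mktuple.
Qed.

Lemma measurable_preimage_tsel M N (s : 'I_N -> 'I_M) B : measurable B ->
  measurable ((tsel s : M.-tuple T -> N.-tuple T) @^-1` B).
Proof. by move=> mB; rewrite -[X in measurable X]setTI; exact: measurable_tsel. Qed.

Lemma measurable_preimage_ins k (i : 'I_k.+1) x (B : set (k.+1.-tuple T)) :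
  measurable B -> measurable (ins i x @^-1` B).
Proof.
move=> mB; rewrite -[X in measurable X]setTI.
exact: (measurable_ins i (f := cst x) (g := id)).
Qed.

Lemma measurable_preimage_cons k x (B : set (k.+1.-tuple T)) :
  measurable B -> measurable (cons_tuple x @^-1` B).
Proof.
move=> mB; rewrite -[X in measurable X]setTI.
exact: (measurable_cons (f := cst x) (g := id)).
Qed.

Lemma measurable_prodmeas_ins k (i : 'I_k.+1) (B : set (k.+1.-tuple T)) :
  measurable B -> measurable_fun setT (fun x => prodmeas mu (ins i x @^-1` B)).
Proof.
move=> mB; apply: measurable_prodmeas_section.
rewrite -[X in measurable X]setTI.
by apply: (measurable_ins i (f := fst) (g := snd)).
Qed.

Lemma prodmeas0_ins k (i : 'I_k.+1) (B : set (k.+1.-tuple T)) : measurable B ->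
  prodmeas mu B = 0%E <->
  mu.-negligible [set x | prodmeas mu (ins i x @^-1` B) != 0%E].
Proof.
move=> mB; rewrite (prodmeas_ins i mB) ge0_integral_eq0P//.
  exact: measurable_prodmeas_ins.
by move=> x; apply: prodmeas_ge0; exact: measurable_preimage_ins.
Qed.

(** Induction on [M], slicing along the first of the [M] coordinates. *)
Lemma prodmeas0_tsel M N (s : 'I_N -> 'I_M) (B : set (N.-tuple T)) :
  injective s -> measurable B -> prodmeas mu B = 0%E ->
  prodmeas mu (tsel s @^-1` B) = 0%E.
Proof.
elim: M N s B => [|M IH] N s B sI mB B0.
  case: N s B sI mB B0 => [|N] s B sI mB; last by case: (s ord0).
  rewrite (_ : tsel s = id) ?preimage_id//; apply/funext => t.
  by rewrite [LHS]tuple0 [RHS]tuple0.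
apply/(prodmeas0_ins ord0 (measurable_preimage_tsel s mB)).
have [i /eqP si|s0] := pickP (fun i => s i == ord0).
  (* The first coordinate is selected at place [i] only, by injectivity: its slices are pullbacks,
     along the remaining selection [s'], of slices of [B] at [i], almost all of which are null. *)
  case: N i s B sI mB B0 si => [[]//|N] i s B sI mB /(prodmeas0_ins i mB) Bi si.
  have [s' s'E] : exists s' : 'I_N -> 'I_M, forall j, s (lift i j) = lift ord0 (s' j).
    apply: (fin_all_exists (P := fun j a => s (lift i j) = lift ord0 a)) => j.
    case: (unliftP ord0 (s (lift i j))) => [a ->|]; first by exists a.
    by rewrite -si => /sI/eqP; rewrite eq_sym (negPf (neq_lift _ _)).
  apply: negligibleS Bi => x /=; apply: contraNN => /eqP Bx.
  apply/eqP; rewrite -(IH _ s' _ _ (measurable_preimage_ins i x mB) Bx).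
    have E t : tsel s (ins ord0 x t) = ins i x (tsel s' t).
      rewrite ins0; apply: eq_from_tnth => j; rewrite !tnth_mktuple.
      case: (unliftP i j) => [a ->|->] /=; first by rewrite s'E tnthS tnth_mktuple.
      by rewrite si.
    by congr prodmeas; apply/seteqP; split=> t; rewrite /preimage /= E.
  by move=> a b ab; apply: (@lift_inj _ i); apply: sI; rewrite !s'E ab.
(* The first coordinate is not selected: every slice is a pullback of [B] itself from one coordinate
   fewer. *)
have [s' s'E] : exists s' : 'I_N -> 'I_M, forall j, s j = lift ord0 (s' j).
  apply: (fin_all_exists (P := fun j a => s j = lift ord0 a)) => j.
  case: (unliftP ord0 (s j)) => [a ->|]; first by exists a.
  by move/eqP; rewrite s0.
apply: negligibleS (negligible_set0 _) => x /=; apply: contraNP => _.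
apply/eqP; rewrite -(IH _ s' _ _ mB B0).
  have E t : tsel s (ins ord0 x t) = tsel s' t.
    rewrite ins0; apply: eq_from_tnth => j.
    by rewrite !tnth_mktuple s'E tnthS.
  by congr prodmeas; apply/seteqP; split=> t; rewrite /preimage /= E.
by move=> a b ab; apply: sI; rewrite !s'E ab.
Qed.

Lemma dknull_tsel M N (s : 'I_N -> 'I_M) (A : set (N.-tuple T)) :
  injective s -> dknull mu A -> dknull mu (tsel s @^-1` A).
Proof.
move=> sI [B [mB AB B0]]; exists (tsel s @^-1` B); split.
- exact: measurable_preimage_tsel.
- by move=> z /AB.
- exact: prodmeas0_tsel.
Qed.

Lemma dknull_section k (A : set (k.+1.-tuple T)) : dknull mu A ->
  mu.-negligible [set x | ~ dknull mu (cons_tuple x @^-1` A)].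
Proof.
move=> [B [mB AB]] /(prodmeas0_ins ord0 mB); apply: negligibleS => x /= nA.
apply/eqP => Bx; apply: nA; exists (ins ord0 x @^-1` B); split=> //.
  exact: measurable_preimage_ins.
by move=> t /AB /=; rewrite ins0.
Qed.

Lemma dknull_thead (A : set T) : mu.-negligible A ->
  dknull mu [set t : 1.-tuple T | A (thead t)].
Proof.
move=> [B [mB B0 AB]].
have mB1 : measurable [set t : 1.-tuple T | B (thead t)].
  by rewrite -[X in measurable X]setTI; apply: measurable_tnth.
exists [set t : 1.-tuple T | B (thead t)]; split=> //; first by move=> t /AB.
apply/(prodmeas0_ins ord0 mB1); exists B; split=> // x /= nx.
apply: contra_notP (elimN eqP nx) => Bx.
rewrite (_ : _ @^-1` _ = set0).
  by apply/dknullP; [exact: measurable0|exact: dknull0].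
by apply/seteqP; split=> t //=; rewrite ins0.
Qed.

(** If [A] is not negligible, no power of it is null: the sections of a power at points of [A]
    contain the previous power, and the empty power is a point of mass 1. *)
Lemma dknull_power k (A : set T) :
  dknull mu [set t : k.-tuple T | forall i, A (tnth t i)] ->
  mu.-negligible A.
Proof.
case: (pselect (mu.-negligible A)) => // nA A0; exfalso.
elim: k A0 => [|k IH A0].
  rewrite (_ : [set _ | _] = setT); last by apply/seteqP; split=> // t _ [].
  move/(dknullP measurableT); rewrite /prodmeas /= indicT => /eqP.
  by rewrite eqe oner_eq0.
apply: nA; apply: negligibleS (dknull_section A0) => x Ax /= nx.
apply: IH; apply: dknullS nx => t /= At i.
by case: (unliftP ord0 i) => [j ->|->]; rewrite ?tnthS.
Qed.

(** This is how the non-vanishing of [mu] enters: almost every section yields an actual one. *)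
Lemma ae_exists (P : set T) : mu setT <> 0%E -> mu.-negligible (~` P) ->
  exists x, P x.
Proof.
move=> mu0 nP; apply: contrapT => nex; apply: mu0.
apply: (measure_negligible measurableT); apply: negligibleS nP => x _ Px.
by apply: nex; exists x.
Qed.

Lemma tsel_rshiftS K k x (z : (K + k).-tuple T) :
  tsel (@rshift K.+1 k) (cons_tuple x z) = tsel (@rshift K k) z.
Proof.
apply: eq_from_tnth => i; rewrite !tnth_mktuple.
by rewrite (_ : rshift K.+1 i = lift ord0 (rshift K i)) ?tnthS//; apply: val_inj.
Qed.

Lemma tsel_rshift0 k (z : k.-tuple T) : tsel (@rshift 0 k) z = z.
Proof.
apply: eq_from_tnth => i; rewrite tnth_mktuple.
by congr tnth; apply: val_inj.
Qed.

(** The leading coordinates are removed one at a time: each section of the cylinder is the cylinder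
    with one coordinate fewer, and some section is null. *)
Lemma dknull_drop K k (A : set (k.-tuple T)) : mu setT <> 0%E ->
  dknull mu (tsel (@rshift K k) @^-1` A) -> dknull mu A.
Proof.
move=> mu0; elim: K => [|K IH] A0.
  by apply: dknullS A0 => t At /=; rewrite tsel_rshift0.
have [|x nx] := ae_exists mu0 (P := [set x | dknull mu (tsel (@rshift K k) @^-1` A)]).
  apply: negligibleS (dknull_section A0) => x /= nA nx; apply: nA.
  by apply: dknullS nx => t /= At; rewrite tsel_rshiftS.
exact: IH.
Qed.

Lemma dkmeasurable_drop K k (A : set (k.-tuple T)) : mu setT <> 0%E ->
  dkmeasurable mu (tsel (@rshift K k) @^-1` A) -> dkmeasurable mu A.
Proof.
move=> mu0; elim: K => [|K IH] [B [mB AB]].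
  exists B; split=> //; apply: dknullS AB => t.
  by rewrite /= tsel_rshift0.
apply: IH.
have [|x nx] := ae_exists mu0 (P := [set x | dknull mu (cons_tuple x @^-1`
    ((tsel (@rshift K.+1 k) @^-1` A) `\` B `|` B `\` (tsel (@rshift K.+1 k) @^-1` A)))]).
  exact: dknull_section.
(* At such an [x] the section of [B] still approximates the shorter cylinder up to a null set. *)
exists (cons_tuple x @^-1` B); split; first exact: measurable_preimage_cons.
by apply: dknullS nx => t /=; rewrite tsel_rshiftS.
Qed.

Lemma dkmeasurable_tsel M N (s : 'I_N -> 'I_M) (A : set (N.-tuple T)) :
  injective s -> dkmeasurable mu A -> dkmeasurable mu (tsel s @^-1` A).
Proof.
move=> sI [B [mB AB]]; exists (tsel s @^-1` B); split.
  exact: measurable_preimage_tsel.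
exact: (dknull_tsel sI AB).
Qed.

Lemma sigma_algebra_dkmeasurable k : sigma_algebra setT (@dkmeasurable _ _ _ mu k).
Proof.
split.
- exists set0; split; first exact: measurable0.
  by rewrite setDv setU0; exact: dknull0.
- move=> A [B [mB AB]]; exists (~` B); split; first exact: measurableC.
  rewrite setTD; apply: dknullS AB => t /=.
  by move=> [[nA /contrapT]|[nB /contrapT]]; [right|left].
- move=> F mF.
  have [B BP] := choice mF; exists (\bigcup_n B n); split.
    by apply: bigcupT_measurable => n; have [] := BP n.
  apply: dknullS (dknull_bigcup (fun n => (BP n).2)) => t.
  case=> -[[n _ Fn] nB]; exists n => //; [left|right]; split=> // Bn;
    by apply: nB; exists n.
Qed.

(** The completed sigma-algebra as a measurable space, so that sums and products of measurable
    functions are available. *)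
Definition dkalg k := g_sigma_algebraType (@dkmeasurable _ _ _ mu k).

Lemma dkmeasurable_funP k (f : k.-tuple T -> R) :
  dkmeasurable_fun mu f <-> measurable_fun [set: dkalg k] f.
Proof.
have E : @measurable _ (dkalg k) = @dkmeasurable _ _ _ mu k.
  exact: (sigma_algebra_id (@sigma_algebra_dkmeasurable k)).
split=> [mf _ Y mY|mf Y mY]; first by rewrite setTI E; exact: mf.
by have := mf measurableT Y mY; rewrite setTI E.
Qed.

Lemma dkmeasurable_fun_sum k (I : eqType) (r : seq I) (a : I -> R)
    (f : I -> k.-tuple T -> R) :
  (forall i, i \in r -> dkmeasurable_fun mu (f i)) ->
  dkmeasurable_fun mu (fun x => \sum_(i <- r) a i * f i x).
Proof.
move=> mf; apply/dkmeasurable_funP.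
elim: r mf => [|i r IH] mf.
  rewrite (_ : (fun _ => _) = cst 0); first exact: measurable_cst.
  by apply/funext => x; rewrite big_nil.
rewrite (_ : (fun _ => _) = (fun x => a i * f i x + \sum_(j <- r) a j * f j x)).
  apply: (@measurable_funD _ (dkalg k) R setT (fun x => a i * f i x)).
    apply: (@measurable_funM _ (dkalg k) R setT (cst (a i)) (f i)) => //.
    by apply/dkmeasurable_funP; apply: mf; rewrite mem_head.
  by apply: IH => j jr; apply: mf; rewrite inE jr orbT.
by apply/funext => x; rewrite big_cons.
Qed.

End ProductMeasure.

Lemma sigma_finite_measure_of d (T : measurableType d) (R : realType)
    (mu : {measure set T -> \bar R}) : sigma_finite setT mu ->
  exists nu : {sigma_finite_measure set T -> \bar R},
    (nu : {measure set T -> \bar R}) = mu.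
Proof.
case: mu => mu c sf.
pose m := Measure.Pack c.
pose nuS := Measure_isSigmaFinite.Build _ _ _ m sf.
pose nu : {sigma_finite_measure set T -> \bar R} := HB.pack (mu : set T -> \bar R) m nuS.
by exists nu; case: c @m sf @nuS @nu.
Qed.

(** * Inversion of G *)

Definition increasing m N (s : {ffun 'I_m -> 'I_N}) :=
  [forall i : 'I_m, forall j : 'I_m, (i < j)%N ==> (s i < s j)%N].

Lemma increasing_inj m N (s : {ffun 'I_m -> 'I_N}) : increasing s -> injective s.
Proof.
move=> /forallP sinc i j sij; apply: contraTeq isT => ij.
wlog ltij : i j sij ij / (i < j)%N.
  move=> H; have := ij; rewrite -val_eqE neq_ltn => /orP[|]; first exact: H.
  by apply: H => //; rewrite eq_sym.
by have := sinc i => /forallP/(_ j)/implyP/(_ ltij); rewrite sij ltnn.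
Qed.

Section Gop.
Context {T : Type} {R : realType}.
Implicit Types N m : nat.

Lemma GopE N m (u : m.-tuple T -> R) x :
  Gop N m u x = ('C(N, m)%:R)^-1 * \sum_(s | increasing s) u (tsel s x).
Proof. by []. Qed.

Lemma card_increasing N m :
  \sum_(s : {ffun 'I_m -> 'I_N} | increasing s) 1 = 'C(N, m)%:R :> R.
Proof.
have := @sum_increasing R N m (fun=> 1); rewrite /increasing => ->.
by rewrite big_const_seq count_predT size_subwords size_enum_ord iter_addr_0.
Qed.

(** Bridge from words to [Gop]: [z] reads letters as points. The default [0] of [nth] is never
    reached, as the words have lengths [m] and [N]. *)
Lemma Gop_wsub N m (u : m.-tuple T -> R) (z : nat -> T) (W : seq nat) :
  (m <= N)%N -> size W = N ->
  wsub (fun=> 1) (fun v => u [tuple z (nth 0%N v i) | i < m]) m W =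
  'C(N, m)%:R * Gop N m u [tuple z (nth 0%N W i) | i < N].
Proof.
move=> mN sW; rewrite GopE mulrA divff ?mul1r; last first.
  by rewrite pnatr_eq0 -lt0n bin_gt0.
have WE : W = [seq nth 0%N W i | i : 'I_N <- enum 'I_N].
  rewrite -{1}(mkseq_nth 0%N W) /mkseq sW -val_enum_ord -map_comp.
  exact: eq_map.
rewrite wsub1E {1}WE map_subwords big_map -sum_increasing.
apply: eq_bigr => s _; congr u; apply: eq_from_tnth => i.
rewrite !tnth_mktuple -map_comp (nth_map i) ?size_enum_ord//.
by rewrite nth_ord_enum.
Qed.

Lemma le_Gop N m (u : m.-tuple T -> R) x (M : \bar R) : (m <= N)%N ->
  (forall s : {ffun 'I_m -> 'I_N}, increasing s -> `|u (tsel s x)|%:E <= M)%E ->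
  (`|Gop N m u x|%:E <= M)%E.
Proof.
move=> mN uM; have C0 : (0 : R) < 'C(N, m)%:R by rewrite ltr0n bin_gt0.
case: M uM => [M| |] uM; [|exact: leey|].
  rewrite lee_fin GopE normrM ger0_norm ?invr_ge0 ?ler0n// ler_pdivrMl//.
  rewrite -card_increasing mulr_suml.
  apply: le_trans (ler_norm_sum _ _ _) _; apply: ler_sum => s sinc.
  by rewrite mul1r -lee_fin; exact: uM.
(* For [M = -oo] no increasing map could exist, although there are ['C(N, m)] of them. *)
exfalso; move: C0; rewrite -card_increasing big1 ?ltxx// => s /uM.
by rewrite leeNy_eq.
Qed.

Lemma Gop_gt N m (u : m.-tuple T -> R) x (M : \bar R) : (m <= N)%N ->
  (forall s : {ffun 'I_m -> 'I_N}, increasing s -> M < (u (tsel s x))%:E)%E ->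
  (M < (Gop N m u x)%:E)%E.
Proof.
move=> mN uM; have C0 : (0 : R) < 'C(N, m)%:R by rewrite ltr0n bin_gt0.
have [s0 s0inc] : exists s0 : {ffun 'I_m -> 'I_N}, increasing s0.
  apply: contrapT => ns; move: C0; rewrite -card_increasing big1 ?ltxx// => s sinc.
  by exfalso; apply: ns; exists s.
case: M uM => [M| |] uM; [|by have := uM _ s0inc|exact: ltNyr].
rewrite lte_fin GopE ltr_pdivlMl// -card_increasing mulr_suml; apply: ltr_sum.
  by apply/hasP; exists s0; rewrite ?mem_index_enum.
by move=> s sinc; rewrite mul1r -lte_fin; exact: uM.
Qed.

Lemma GopN N m (u : m.-tuple T -> R) x :
  Gop N m (fun t => - u t) x = - Gop N m u x.
Proof. by rewrite !GopE sumrN mulrN. Qed.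

End Gop.

(** [word_wspan] with weights 1, applied to the word 0, ..., m-1; [K] and [L] precede [T] and
    [u]. *)
Lemma Gop_inversion (R : realType) N m : (0 < m <= N)%N ->
  exists (K : nat) (L : seq (R * {ffun 'I_N -> 'I_(K + m)})),
    (forall p, p \in L -> injective p.2) /\
    forall (T : Type) (u : m.-tuple T -> R) (z : (K + m).-tuple T),
      u (tsel (@rshift K m) z) = \sum_(p <- L) p.1 * Gop N m u (tsel p.2 z).
Proof.
move=> /andP[m0 mN].
have [|||L [HL EL]] := @word_wspan R (fun=> 1) m N [::] (iota 0 m) (fun=> ltr01) mN.
- exact: iota_uniq.
- exact: size_iota.
- exact/allP.
(* Strictly above every letter used in [L], so that distinct letters stay distinct modulo
   [K + m]. *)
pose K := \max_(p <- L) \max_(j <- p.2) j.+1.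
have LK p j : p \in L -> j \in p.2 -> (j < K)%N.
  move=> pL jp; rewrite /K (big_rem p)//= leq_max (big_rem j jp)/= leq_max.
  by rewrite leqnn.
have Km : (0 < K + m)%N by rewrite addn_gt0 m0 orbT.
(* The letters 0, ..., m-1 label the last m coordinates, so that dropping the
   other ones amounts to iterated sections along the first coordinate. *)
pose e j : 'I_(K + m) := Ordinal (ltn_pmod (j + K) Km).
have eI i j : (i < K)%N -> (j < K)%N -> e i = e j -> i = j.
  move=> iK jK /(congr1 val) /= /eqP; rewrite eqn_modDr => /eqP.
  by rewrite !modn_small// ltn_addr.
exists K, [seq (p.1 * 'C(N, m)%:R, [ffun i : 'I_N => e (nth 0%N p.2 i)]) | p <- L].
split.
  move=> _ /mapP[p pL ->] /= i j; rewrite !ffunE.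
  have [up sp _] := HL p pL.
  have Np k : nth 0%N p.2 (k : 'I_N) \in p.2 by rewrite mem_nth ?sp.
  move/eI => /(_ (LK _ _ pL (Np i)) (LK _ _ pL (Np j)))/eqP.
  by rewrite nth_uniq ?sp// => /eqP/val_inj.
move=> T u z; pose x j := tnth z (e j).
have := EL (fun v => u [tuple x (nth 0%N v i) | i < m]).
rewrite big_map => E; transitivity (u [tuple x (nth 0%N (iota 0 m) i) | i < m]).
  congr u; apply: eq_from_tnth => i; rewrite !tnth_mktuple nth_iota//.
  rewrite /x; congr tnth; apply: val_inj; rewrite /= add0n addnC modn_small//.
  by have := ltn_ord i; lia.
rewrite E !big_seq; apply: eq_bigr => p pL /=.
have [_ sp _] := HL p pL.
rewrite (Gop_wsub u x mN sp) mulrA; congr (_ * Gop _ _ _ _).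
by apply: eq_from_tnth => i; rewrite !tnth_mktuple ffunE.
Qed.

(** * Measurability and essential bounds of [u] and [Gop N m u] *)

Section Norm.
Context {d : measure_display} {T : measurableType d} {R : realType}.
Variable mu : {sigma_finite_measure set T -> \bar R}.
Hypothesis mu0 : mu setT <> 0%E.
Variables N m : nat.
Hypothesis m0N : (0 < m <= N)%N.
Implicit Type u : m.-tuple T -> R.

Let mN : (m <= N)%N. Proof. by case/andP: m0N. Qed.

Lemma dkmeasurable_fun_tsel k l (s : 'I_l -> 'I_k) (f : l.-tuple T -> R) :
  injective s -> dkmeasurable_fun mu f -> dkmeasurable_fun mu (f \o tsel s).
Proof. by move=> sI mf Y mY; exact: dkmeasurable_tsel (mf Y mY). Qed.

Lemma dkmeasurable_Gop u : dkmeasurable_fun mu u -> dkmeasurable_fun mu (Gop N m u).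
Proof.
move=> mu_; rewrite (_ : Gop N m u = fun x => \sum_(s <- [seq s : {ffun 'I_m -> 'I_N} <-
    index_enum _ | increasing s]) ('C(N, m)%:R)^-1 * (u \o tsel s) x).
  apply: dkmeasurable_fun_sum => s; rewrite mem_filter => /andP[sinc _].
  exact: dkmeasurable_fun_tsel (increasing_inj sinc) mu_.
by apply/funext => x; rewrite GopE big_filter mulr_sumr.
Qed.

Lemma dkmeasurable_of_Gop u : dkmeasurable_fun mu (Gop N m u) -> dkmeasurable_fun mu u.
Proof.
move=> mU; have [K [L [LI E]]] := Gop_inversion R m0N.
have mL : dkmeasurable_fun mu (u \o tsel (@rshift K m)).
  rewrite (_ : _ \o _ = fun z => \sum_(p <- L) p.1 * (Gop N m u \o tsel p.2) z).
    by apply: dkmeasurable_fun_sum => p pL; apply: dkmeasurable_fun_tsel (LI p pL) mU.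
  by apply/funext => z /=; rewrite E.
by move=> Y mY; apply: (dkmeasurable_drop mu0) (mL Y mY).
Qed.

Lemma dknull_has k (I : eqType) (r : seq I) (A : I -> set (k.-tuple T)) :
  (forall i, i \in r -> dknull mu (A i)) ->
  dknull mu [set x | exists2 i, i \in r & A i x].
Proof.
elim: r => [|i r IH] A0; first by apply: dknullS (dknull0 _ _) => x [].
apply: dknullS (dknullU (A0 i (mem_head _ _)) (IH _)) => [x [j]|j jr].
  by rewrite inE => /orP[/eqP -> ?|jr Aj]; [left|right; exists j].
by apply: A0; rewrite inE jr orbT.
Qed.

(** An average exceeding [M] in absolute value has a term that does, so the set is covered by
    finitely many pullbacks. *)
Lemma dknull_Gop u (M : \bar R) : dknull mu [set x | (M < `|u x|%:E)%E] ->
  dknull mu [set x | (M < `|Gop N m u x|%:E)%E].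
Proof.
move=> u0.
apply: dknullS (dknull_has (r := [seq s : {ffun 'I_m -> 'I_N} <- index_enum _ | increasing s])
  (A := fun s => tsel s @^-1` [set x | (M < `|u x|%:E)%E]) _) => [x /=|s].
  rewrite ltNge => /negP nU; apply: contrapT => ns; apply: nU.
  apply: le_Gop => // s sinc; rewrite leNgt; apply/negP => us; apply: ns.
  by exists s; rewrite // mem_filter sinc mem_index_enum.
rewrite mem_filter => /andP[sinc _].
exact: dknull_tsel (increasing_inj sinc) u0.
Qed.

Lemma dknull1_of_Gop (u : 1.-tuple T -> R) (M : \bar R) : (0 < N)%N ->
  dknull mu [set x | (M < `|Gop N 1 u x|%:E)%E] ->
  dknull mu [set x | (M < `|u x|%:E)%E].
Proof.
move=> N0 U0.
(* Terms of opposite sign could cancel in the average, so [u > M] and [- u > M] are treated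
   separately. *)
have key (v : 1.-tuple T -> R) : (forall x, `|Gop N 1 v x| = `|Gop N 1 u x|) ->
    dknull mu [set t : 1.-tuple T | (M < (v t)%:E)%E].
  move=> vu; pose A := [set a : T | (M < (v [tuple a])%:E)%E].
  have v1 (t : 1.-tuple T) : v t = v [tuple thead t].
    by congr v; rewrite [LHS]tuple_eta; apply: val_inj; rewrite /= [behead _]size0nil // size_behead size_tuple.
  have /dknull_thead : mu.-negligible A.
    apply: (@dknull_power _ _ _ mu N); apply: dknullS U0 => x /= Ax.
    rewrite -vu; apply: (@lt_le_trans _ _ (Gop N 1 v x)%:E).
      by apply: Gop_gt => // s _; rewrite v1 /thead tnth_mktuple; exact: Ax.
    by rewrite lee_fin ler_norm.
  by apply: dknullS => t vt; have := vt; rewrite /= v1.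
apply: dknullS (dknullU (key u (fun=> erefl)) (key (fun t => - u t) _)) => [t /=|x].
  by case: (ger0P (u t)) => _; [left|right].
by rewrite GopN normrN.
Qed.

Lemma dknorm_inf_Gop u : (dknorm_inf mu (Gop N m u) <= dknorm_inf mu u)%E.
Proof.
apply: le_ereal_inf_tmp => M /= uM.
by apply: ereal_inf_lbound; exact: dknull_Gop.
Qed.

End Norm.

Theorem theorem2 (R : realType) :
  exists C : nat -> nat -> R,
    (forall N : nat, (1 <= N)%N -> C N 1%N = 1) /\
    forall (d : measure_display) (T : measurableType d)
           (mu : {measure set T -> \bar R}),
      sigma_finite setT mu -> measure_is_complete mu -> mu setT <> 0%E ->
      forall (N m : nat), (1 <= m)%N -> (m <= N)%N ->
      forall u : m.-tuple T -> R,
        (* (i) *)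
        (dkmeasurable_fun mu (Gop N m u) <-> dkmeasurable_fun mu u) /\
        (* (ii) *)
        (dkLinf mu (Gop N m u) <-> dkLinf mu u) /\
        (dkLinf mu u ->
           (dknorm_inf mu (Gop N m u) <= dknorm_inf mu u)%E /\
           (dknorm_inf mu u <= (C N m)%:E * dknorm_inf mu (Gop N m u))%E).
Proof.
(* The norm bound in terms of null sets, over all spaces at once, so that [C] is chosen before the
   space. *)
pose P N m C := forall (d : measure_display) (T : measurableType d)
  (mu : {sigma_finite_measure set T -> \bar R}), mu setT <> 0%E ->
  forall (u : m.-tuple T -> R) (M : \bar R),
    dknull mu [set x | (M < `|Gop N m u x|%:E)%E] ->
    dknull mu [set x | (C%:E * M < `|u x|%:E)%E].
have PC N m : (0 < m <= N)%N -> exists C : R, 0 < C /\ P N m C.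
  move=> m0N; have [K [L [LI E]]] := Gop_inversion R m0N.
  pose C := \sum_(p <- L) `|p.1|.
  have C0 : 0 < C.
    (* If all coefficients vanished, inverting the constant function 1 would give 1 = 0. *)
    rewrite lt0r sumr_ge0 ?andbT//; apply/eqP => C0.
    have := E unit (fun=> 1) [tuple tt | i < K + m].
    rewrite big_seq big1 => [/eqP|p pL]; first by rewrite oner_eq0.
    suff -> : p.1 = 0 by rewrite mul0r.
    apply/eqP; rewrite -normr_eq0; apply/eqP/le_anti.
    by rewrite normr_ge0 -C0 /C (big_rem p)//= lerDl sumr_ge0.
  exists C; split=> // d T mu mu0 u M U0.
  apply: (dknull_drop (K := K) mu0).
  apply: dknullS (dknull_has (r := L)
    (A := fun p => tsel p.2 @^-1` [set x | (M < `|Gop N m u x|%:E)%E]) _) => [z|p pL].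
    rewrite /= E ltNge => /negP nu; apply: contrapT => nU; apply: nu.
    have UM p : p \in L -> (`|Gop N m u (tsel p.2 z)|%:E <= M)%E.
      by move=> pL; rewrite leNgt; apply/negP => pM; apply: nU; exists p.
    case: M UM {U0 nU} => [M| |] UM.
    - rewrite -EFinM lee_fin /C mulr_suml.
      apply: le_trans (ler_norm_sum _ _ _) _; rewrite big_seq [leRHS]big_seq.
      by apply: ler_sum => p /UM; rewrite lee_fin => ?; rewrite normrM ler_wpM2l.
    - by rewrite gt0_muley ?leey// lte_fin.
    - exfalso; move: C0; rewrite /C big_seq big1 ?ltxx// => p /UM.
      by rewrite leeNy_eq.
  exact: dknull_tsel (LI p pL) U0.
have PC' (p : nat * nat) : exists C : R, (0 < p.2 <= p.1)%N -> 0 < C /\ P p.1 p.2 C.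
  by have [/PC[C CP]|] := boolP (0 < p.2 <= p.1)%N; [exists C|exists 0].
have [C CP] := choice PC'.
(* For [m = 1] the inversion constant is replaced by 1, justified by [dknull1_of_Gop]. *)
exists (fun N m => if m == 1%N then 1 else C (N, m)); split=> // d T mu0 sf _.
have [mu <-] := sigma_finite_measure_of sf => {mu0 sf} mu0 N m m0 mN u.
have m0N : (0 < m <= N)%N by rewrite m0.
have [C0 Cu] := CP (N, m) m0N.
have mE : dkmeasurable_fun mu (Gop N m u) <-> dkmeasurable_fun mu u.
  by split; [exact: dkmeasurable_of_Gop|exact: dkmeasurable_Gop].
(* Each essential bound [M] of [Gop N m u] gives the bound [c * M] of [u]; dividing by [c] allows
   passing to the infimum over [M]. *)
have le_norm c : 0 < c -> (forall M,
    dknull mu [set x | (M < `|Gop N m u x|%:E)%E] ->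
    dknull mu [set x | (c%:E * M < `|u x|%:E)%E]) ->
    (dknorm_inf mu u <= c%:E * dknorm_inf mu (Gop N m u))%E.
  move=> c0 cu; rewrite -lee_pdivrMl//; apply: le_ereal_inf_tmp => M /= UM.
  by rewrite lee_pdivrMl//; apply: ereal_inf_lbound; exact: cu.
have Unorm := dknorm_inf_Gop mu m0N u.
split=> //; split.
  rewrite /dkLinf mE; split=> -[mu_ fin]; split=> //; last exact: le_lt_trans fin.
  apply: le_lt_trans (le_norm _ C0 (Cu _ _ _ mu0 u)) _.
  case: (dknorm_inf _ _) fin => [r| |] //= _; first by rewrite -EFinM ltry.
  by rewrite gt0_muleNy ?lte_fin.
move=> _; split=> //; case: eqP => [m1|_]; last exact: le_norm (Cu _ _ _ mu0 u).
rewrite {}m1 in u m0 mN m0N le_norm mE C0 Cu Unorm *.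
by apply: le_norm => // M; rewrite mul1e; exact: dknull1_of_Gop.
Qed.
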